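(* Let $\phi$ be an arbitrarily slowly growing function, i.e. any positive function of $n$ with $\phi(n)\to\infty$ as $n\to\infty$, such that $\phi(n) < n/\log_2 n$. Then there is a function $\delta(n)$ with $\delta(n) = o(1)$ as $n\to\infty$ such that for all sufficiently large $n$ $$L(n,0) \;\leq\; \frac{3n2^{n+4}}{\log_2 n - \log_2\log_2 n - \log_2\phi(n)}\,\bigl(1+\epsilon(n)\bigr),$$ where $$\epsilon(n) = \frac{1}{6\phi(n)} + \left(\frac{8}{3} - \delta(n)\right)\frac{\log_2 n\cdot \log_2\log_2 n}{n}.$$
   Context: For $n\ge 1$, $j\in\{1,\dots,n\}$ and $I \subseteq \{1,\dots,n\}\setminus\{j\}$, the gate $TOF(I;j)$ on $n$ inputs defines the transformation $\mathbb{Z}_2^n \to \mathbb{Z}_2^n$ that replaces $x_j$ by $x_j \oplus \bigwedge_{i\in I} x_i$ and leaves all other coordinates unchanged; for $I=\emptyset$ it is the NOT gate $x_j \mapsto x_j\oplus 1$. Let $\Omega_n^2$ be the set of all gates $TOF(I;j)$ on $n$ inputs with $|I|\le 2$ (NOT, CNOT and 2-CNOT gates). A reversible circuit $\mathfrak{S}$ with $n$ inputs is a finite sequence (composition) of $l\ge 0$ gates from $\Omega_n^2$, applied one after another; it defines a transformation $g:\mathbb{Z}_2^n\to\mathbb{Z}_2^n$. Its gate complexity is $L(\mathfrak{S}) = l$. A reversible circuit with $n$ inputs defining $g$ implements $f:\mathbb{Z}_2^n\to\mathbb{Z}_2^n$ without additional inputs if there is a permutation $\pi$ of $\{1,\dots,n\}$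 such that for every $x\in\mathbb{Z}_2^n$, writing $g(x) = (y_1,\dots,y_n)$, one has $f(x) = (y_{\pi(1)},\dots,y_{\pi(n)})$. $F(n,0)$ is the set of all transformations $\mathbb{Z}_2^n\to\mathbb{Z}_2^n$ that can be implemented in this way by reversible circuits with $n$ inputs (gates from $\Omega_n^2$). For $f\in F(n,0)$, $L(f,0)$ is the minimum of $L(\mathfrak{S})$ over all circuits $\mathfrak{S}$ of gates from $\Omega_n^2$ implementing $f$ without additional inputs, and $L(n,0) = \max_{f\in F(n,0)} L(f,0)$. *)

(* Defs.v *)
From mathcomp Require Import all_boot all_fingroup all_order all_algebra.
From mathcomp Require Import boolp reals exp.

Set Implicit Arguments.
Unset Strict Implicit.
Unset Printing Implicit Defensive.

Import GRing.Theory.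

(* Z_2 is represented by bool, with (+) as addition and && as product. *)
Notation bitvec n := {ffun 'I_n -> bool}.
Notation transf n := {ffun bitvec n -> bitvec n}.

(* The pair (I, j) encodes the gate TOF(I; j); the side conditions on I and j
   are imposed by membership in Omega2. *)
Notation gate n := ({set 'I_n} * 'I_n)%type.

Definition TOF n (I : {set 'I_n}) (j : 'I_n) (x : bitvec n) : bitvec n :=
  [ffun k => if k == j then x j (+) [forall i in I, x i] else x k].

Definition Omega2 n : {set gate n} :=
  [set g : gate n | (g.2 \notin g.1) && (#|g.1| <= 2)%N].

Definition circuit n (S : seq (gate n)) : Prop := {subset S <= Omega2 n}.

(* The head of the list is the gate applied first. *)
Definition circuit_transf n (S : seq (gate n)) (x : bitvec n) : bitvec n :=
  foldl (fun y g => TOF g.1 g.2 y) x S.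

Definition implements n (S : seq (gate n)) (f : transf n) : Prop :=
  exists p : 'S_n, forall x, f x = [ffun k => circuit_transf S x (p k)].

Definition implementable_with n (f : transf n) (l : nat) : bool :=
  `[< exists S : seq (gate n), [/\ circuit S, size S = l & implements S f] >].

Definition F0 n : {set transf n} :=
  [set f : transf n |
     `[< exists S : seq (gate n), circuit S /\ implements S f >]].

(* L(f, 0); the value 0 outside F(n, 0) is never used. *)
Definition Lf0 n (f : transf n) : nat :=
  if pselect (exists l, implementable_with f l) is left h then ex_minn h else 0.

(* L(n, 0); F(n, 0) contains the identity, so this is a genuine maximum. *)
Definition Ln0 n : nat := \max_(f in F0 n) Lf0 f.

Lemma Lf0_min n (f : transf n) : f \in F0 n ->
  (exists S : seq (gate n), [/\ circuit S, implements S f & size S = Lf0 f]) /\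
  (forall S : seq (gate n), circuit S -> implements S f -> Lf0 f <= size S)%N.
Proof.
rewrite inE => /asboolP [S0 [cS0 iS0]]; rewrite /Lf0.
case: pselect => [h|[]]; last first.
  by exists (size S0); apply/asboolP; exists S0.
case: ex_minnP => m /asboolP [S [cS sS iS]] m_min; split; first by exists S.
by move=> S' cS' iS'; apply: m_min; apply/asboolP; exists S'.
Qed.

Lemma F0_id n : [ffun x : bitvec n => x] \in F0 n.
Proof.
rewrite inE; apply/asboolP; exists [::]; split=> //; exists 1%g => x.
by apply/ffunP => k; rewrite !ffunE perm1.
Qed.

Definition log2 (R : realType) (x : R) : R := (ln x / ln 2)%R.

(* Main.v *)
Require Import Defs.
From mathcomp Require Import all_boot all_order all_algebra.
From mathcomp Require Import all_fingroup zify lra boolp.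

(* A permutation f of Z_2^n implementable by small gates is even when n >= 4, and
   is undone in batches.  As long as f moves at least 3K points, there are K
   points x whose orbit segments {x, f x} are pairwise disjoint; composing f with
   the product of the K transpositions (x, f x) fixes K more points.

   For K = 2^s such a product costs about 10n gates.  The m = 2K points involved
   give at most 2^m distinct columns (the values of one wire on all the points), so
   about n CNOTs bring them to a common value outside 2^m wires; O(m 2^m) further
   gates move the points onto a subcube of dimension s+1, where the product is a
   single multiply-controlled NOT with n-1-s controls, costing at most 8n.  The
   normalisation is applied twice, whence 2n + 8n.

   With L = log n and m the largest power of two below 9L/10, there are 2^n / K
   batches and K >= 9L/40, for a total of about (400/9) n 2^n / L < 48 n 2^n / L. *)

Set Implicit Arguments.
Unset Strict Implicit.
Unset Printing Implicit Defensive.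

(** * Circuits as permutations *)

Section Circuits.
Local Open Scope nat_scope.
Local Open Scope group_scope.
Variable n : nat.
Implicit Types (x y : bitvec n) (I : {set 'I_n}) (j t : 'I_n) (S : seq (gate n)).
Implicit Types (p q f : {perm bitvec n}).

(** An upper bound rather than a minimum, so that costs add under composition; outputs are not
    relabelled. The product [p * q] applies [p] first, as in a list of gates. *)
Definition cost c p :=
  exists S, [/\ circuit S, size S <= c & forall x, circuit_transf S x = p x].

Lemma cost_leq c d p : c <= d -> cost c p -> cost d p.
Proof.
by move=> le_cd [S [cS sS eS]]; exists S; split=> //; apply: leq_trans le_cd.
Qed.

Lemma cost1 : cost 0 1.
Proof. by exists [::]; split=> // x; rewrite perm1. Qed.

Lemma costM c d p q : cost c p -> cost d q -> cost (c + d) (p * q).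
Proof.
move=> [S [cS sS eS]] [S' [cS' sS' eS']]; exists (S ++ S'); split.
- by move=> g; rewrite mem_cat => /orP[/cS|/cS'].
- by rewrite size_cat leq_add.
- by move=> x; rewrite permM -eS -eS' /circuit_transf foldl_cat.
Qed.

Lemma TOFK I j : j \notin I -> involutive (TOF I j).
Proof.
move=> jI x; apply/ffunP=> k; rewrite !ffunE; case: eqP => [->|//].
rewrite eqxx.
have -> : [forall i in I, TOF I j x i] = [forall i in I, x i].
  apply: eq_forallb_in => i iI; rewrite ffunE.
  by case: eqP => // eij; rewrite -eij iI in jI.
by rewrite addbK.
Qed.

(* The guard only makes the map bijective when j is in I. *)
Definition tof_fun I j x := if j \in I then x else TOF I j x.

Lemma tof_funK I j : involutive (tof_fun I j).
Proof. by move=> x; rewrite /tof_fun; case jI: (j \in I) => //; rewrite TOFK ?jI. Qed.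

Definition tofp I j : {perm bitvec n} := perm (inv_inj (tof_funK I j)).

Lemma tofpE I j x k : j \notin I ->
  tofp I j x k = x k (+) ((k == j) && [forall i in I, x i]).
Proof.
move=> jI; rewrite permE /tof_fun (negbTE jI) ffunE.
by case: eqP => [->|]; rewrite ?addbF.
Qed.

Lemma tofpK I j : tofp I j * tofp I j = 1.
Proof. by apply/permP=> x; rewrite permM !permE tof_funK. Qed.

Lemma cost_tofp I j : j \notin I -> #|I| <= 2 -> cost 1 (tofp I j).
Proof.
move=> jI I2; exists [:: (I, j)]; split=> //.
  by move=> g; rewrite inE => /eqP->; rewrite inE jI.
by move=> x; rewrite permE /tof_fun (negbTE jI).
Qed.

Lemma circuit_rev S : circuit S -> circuit (rev S).
Proof. by move=> cS g; rewrite mem_rev => /cS. Qed.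

Lemma circuit_transf_rev S x : circuit S ->
  circuit_transf (rev S) (circuit_transf S x) = x.
Proof.
elim: S x => [//|g S IH] x cS.
rewrite rev_cons /circuit_transf foldl_rcons -!/(circuit_transf _ _) /=.
rewrite -/(circuit_transf S _) IH; last first.
  by move=> h hS; apply: cS; rewrite inE hS orbT.
by rewrite TOFK //; have := cS g; rewrite !inE eqxx /= => /(_ isT)/andP[].
Qed.

Lemma costV c p : cost c p -> cost c p^-1.
Proof.
move=> [S [cS sS eS]]; exists (rev S); split.
- exact: circuit_rev.
- by rewrite size_rev.
- by move=> x; rewrite -{1}(permKV p x) -eS circuit_transf_rev.
Qed.

Lemma costM_tofp c p I j : j \notin I -> #|I| <= 2 ->
  cost c p -> cost c.+1 (tofp I j * p).
Proof. by move=> jI I2 cp; apply: (costM (cost_tofp jI I2) cp). Qed.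

(* Gates with targets outside every control set of the family commute. *)
Lemma cost_layer (F : 'I_n -> {set 'I_n}) (D : {set 'I_n}) :
    {in D, forall k, #|F k| <= 2 /\ [disjoint F k & D]} ->
  exists2 p, cost #|D| p &
    forall x k, p x k = x k (+) ((k \in D) && [forall i in F k, x i]).
Proof.
move=> FD.
suff /(_ (enum D)) H : forall s : seq 'I_n, {subset s <= D} -> uniq s ->
    exists2 p, cost (size s) p &
      forall x k, p x k = x k (+) ((k \in s) && [forall i in F k, x i]).
  have [|p cp pE] := H _ (enum_uniq _); first by move=> k; rewrite mem_enum.
  exists p; first by rewrite cardE.
  by move=> x k; rewrite pE mem_enum.
elim=> [|j s IH] sD /=; first by exists 1; [exact: cost1|move=> x k; rewrite perm1 addbF].
move=> /andP[js us].
have jD : j \in D by apply: sD; rewrite inE eqxx.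
have {}IH := IH (fun k ks => sD k (mem_behead (s := j :: s) ks)) us.
have [p cp pE] := IH.
have [F2 Fdis] := FD j jD.
have jF k : k \in D -> j \notin F k.
  by move=> kD; have [_ Fk] := FD k kD; apply/negP => jFk; rewrite (disjointFr Fk jFk) in jD.
exists (tofp (F j) j * p); first by apply: costM_tofp => //; apply: jF.
move=> x k; rewrite permM pE tofpE ?jF // inE.
have [->|kj] /= := eqVneq k j; first by rewrite (negbTE js) addbF.
rewrite addbF; case ks: (k \in s) => //=; congr (_ (+) _).
apply: eq_forallb_in => i iF; rewrite tofpE ?jF //.
have [eij|] := eqVneq i j; last by rewrite addbF.
by have := jF k (sD k (mem_behead (s := j :: s) ks)); rewrite -eij iF.
Qed.

End Circuits.

(** * Multiply-controlled NOT gates *)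

Section MultiControl.
Local Open Scope nat_scope.
Local Open Scope group_scope.
Variable n : nat.
Implicit Types (x y : bitvec n) (I : {set 'I_n}) (j t d : 'I_n).
Implicit Types (p q f : {perm bitvec n}) (l : seq ('I_n * 'I_n)).

(* Pairs (c, a) of a control and a work wire, outermost first: the ladder adds
   to each work wire the conjunction of the controls from its level inwards. *)
Fixpoint ladder l : {perm bitvec n} :=
  match l with
  | [::] => 1
  | (c, a) :: l' =>
    match l' with
    | [::] => tofp [set c] a
    | (_, a') :: _ => tofp [set c; a'] a * ladder l' * tofp [set c; a'] a
    end
  end.

Fixpoint ladder_flip l x k : bool :=
  if l is (c, a) :: l' then
    if k == a then all (fun i => x i) (unzip1 l) else ladder_flip l' x k
  else false.

Lemma ladder_flip_eq l x y : {in unzip1 l, x =1 y} ->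
  ladder_flip l x =1 ladder_flip l y.
Proof.
elim: l => [//|[c a] l IH] xy k /=; have /= -> := eq_in_all xy.
by rewrite IH // => i il; apply: xy; rewrite inE il orbT.
Qed.

Lemma ladder_flip_out l x k : k \notin unzip2 l -> ladder_flip l x k = false.
Proof. by elim: l => [//|[c a] l IH] /=; rewrite inE negb_or => /andP[/negbTE-> /IH]. Qed.

Lemma forall_set1 (x : bitvec n) c : [forall i in [set c], x i] = x c.
Proof.
apply/forall_inP/idP => [->//|xc i]; first by rewrite inE.
by rewrite inE => /eqP->.
Qed.

Lemma forall_setU1 (x : bitvec n) c I :
  [forall i in c |: I, x i] = x c && [forall i in I, x i].
Proof.
apply/forall_inP/andP => [H|[xc /forall_inP xI] i].
  split; first by apply: H; rewrite !inE eqxx.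
  by apply/forall_inP => i iI; apply: H; rewrite !inE iI orbT.
by rewrite !inE => /orP[/eqP->//|/xI].
Qed.

Lemma uniq_wires_cons c a l :
    uniq (unzip1 ((c, a) :: l) ++ unzip2 ((c, a) :: l)) ->
  [/\ c != a, c \notin unzip2 l, a \notin unzip1 l ++ unzip2 l
    & uniq (unzip1 l ++ unzip2 l)].
Proof.
rewrite /= mem_cat inE !negb_or => /andP[/and3P[_ -> ->]].
by rewrite uniq_catC /= mem_cat orbC -mem_cat uniq_catC => /andP[].
Qed.

(** The two gates on [a] read [a'] before and after the inner ladder, which adds the conjunction of
    the inner controls to [a']. The unknown initial value of [a'] cancels. *)
Lemma ladderE l x k : uniq (unzip1 l ++ unzip2 l) ->
  ladder l x k = x k (+) ladder_flip l x k.
Proof.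
elim: l x k => [|[c a] l IH] x k U; first by rewrite perm1 addbF.
have [ca ac2 a1 Ul] := uniq_wires_cons U.
have c1 : c \notin unzip1 l by move: U => /=; rewrite mem_cat negb_or => /andP[/andP[-> _] _].
have : forall x k, ladder l x k = x k (+) ladder_flip l x k by move=> *; apply: IH.
case: l a1 ac2 Ul c1 {IH U} => [|[c' a'] l] a1 ac2 Ul c1 E; rewrite [ladder _]/=.
  rewrite tofpE; last by rewrite inE eq_sym.
  rewrite forall_set1 /=.
  by case: eqP => //=; rewrite ?andbT.
have aI : a \notin [set c; a'].
  rewrite !inE negb_or eq_sym ca /=; apply: contra a1 => /eqP->.
  by rewrite mem_cat /= !inE eqxx !orbT.
set t := tofp _ a; rewrite !permM tofpE //.
have tE y i : t y i = y i (+) ((i == a) && (y c && y a')).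
  by rewrite tofpE // forall_setU1 forall_set1.
have lx i : ladder ((c', a') :: l) (t x) i =
     t x i (+) ladder_flip ((c', a') :: l) x i.
  rewrite E; congr (_ (+) _); apply: ladder_flip_eq => u ul.
  rewrite tE; case: eqP => [ua|_]; last by rewrite addbF.
  by move: a1; rewrite mem_cat -ua ul.
rewrite forall_setU1 forall_set1 !lx !tE.
have aa' : a' != a by apply: contraNneq aI => <-; rewrite !inE eqxx orbT.
rewrite (negbTE ca) (negbTE aa') /= !addbF.
rewrite -/(ladder_flip ((c', a') :: l) x k) -/(ladder_flip ((c', a') :: l) x c).
have -> : ladder_flip ((c', a') :: l) x c = false by apply: ladder_flip_out.
rewrite eqxx addbF; case: eqP => [->|] /=; last by rewrite !addbF.
have := @ladder_flip_out ((c', a') :: l) x a.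
rewrite [ladder_flip _ _ _]/= => ->; last by move: a1; rewrite mem_cat negb_or => /andP[].
by rewrite addbF -!addbA; congr (_ (+) _); case: (x c); case: (x a'); case: (x c' && _).
Qed.

Lemma cost_ladder l : uniq (unzip1 l ++ unzip2 l) -> cost (size l).*2 (ladder l).
Proof.
elim: l => [|[c a] l IH] U; first exact: cost1.
have [ca ac2 a1 Ul] := uniq_wires_cons U.
case: l a1 ac2 Ul {U} IH => [|[c' a'] l] a1 ac2 Ul IH; rewrite [ladder _]/=.
  by apply: cost_leq (cost_tofp _ _) => //; rewrite ?inE ?cards1 // eq_sym.
have aI : a \notin [set c; a'].
  rewrite !inE negb_or eq_sym ca /=; apply: contra a1 => /eqP->.
  by rewrite mem_cat /= !inE eqxx !orbT.
have I2 : #|[set c; a']| <= 2 by rewrite cards2; case: (_ != _).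
have ct := cost_tofp aI I2.
have := costM (costM ct (IH Ul)) ct; apply: cost_leq.
by rewrite /= !doubleS; lia.
Qed.

(** The work wires in [D] may hold any values. The ladder headed by [(c, t)] acts correctly on [t]
    but disturbs the work wires; the ladder without that head restores them. As [t] is paired with
    the first control, [#|I| - 1] work wires suffice. *)
Lemma cost_tofp_dirty I t (D : {set 'I_n}) :
    t \notin I -> t \notin D -> [disjoint I & D] -> 0 < #|I| <= #|D|.+1 ->
  cost (4 * #|I|) (tofp I t).
Proof.
move=> tI tD dis /andP[I0 ID].
have sE : size (enum I) = #|I| by rewrite cardE.
case e: (enum I) sE => [|c cs] /= sE; first by rewrite -sE in I0.
pose ds := take (size cs) (enum D).
have sds : size ds = size cs by rewrite size_takel // -cardE; rewrite -ltnS sE.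
pose l := zip cs ds.
have u1 : unzip1 ((c, t) :: l) = enum I by rewrite e /= unzip1_zip // sds.
have u2 : unzip2 ((c, t) :: l) = t :: ds by rewrite /= unzip2_zip // sds.
have dsD k : k \in ds -> k \in D by move/mem_take; rewrite mem_enum.
have U : uniq (unzip1 ((c, t) :: l) ++ unzip2 ((c, t) :: l)).
  rewrite u1 u2 cat_uniq enum_uniq /= take_uniq ?enum_uniq // andbT.
  rewrite mem_enum (negbTE tI) /=; apply/andP; split; last by apply: contra tD => /dsD.
  by apply/hasPn => k /dsD kD; rewrite /= mem_enum (disjointFl dis kD).
have Ul : uniq (unzip1 l ++ unzip2 l).
  apply: subseq_uniq U => /=; apply: subseq_trans (subseq_cons _ _).
  by apply: cat_subseq => //; apply: subseq_cons.
have -> : tofp I t = ladder ((c, t) :: l) * ladder l.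
  apply/permP => x; apply/ffunP => k.
  have xI : all (fun i => x i) (unzip1 ((c, t) :: l)) = [forall i in I, x i].
    rewrite u1; apply/allP/forall_inP => H i; have := H i; rewrite mem_enum; exact.
  rewrite tofpE // permM (ladderE _ _ Ul) (ladderE _ _ U).
  (* The second ladder sees the original controls: the first changes only [t] and the work wires. *)
  rewrite (@ladder_flip_eq l _ x); last first.
    move=> i il; rewrite ladderE // ladder_flip_out ?addbF //.
    have : uniq (unzip1 ((c, t) :: l) ++ unzip2 ((c, t) :: l)) := U.
    rewrite cat_uniq => /and3P[_ /hasPn H _]; apply/negP => /H /=.
    by rewrite inE il orbT.
  rewrite -xI [ladder_flip (_ :: _) _ _]/=.
  case: eqP => [->|_]; last by rewrite -addbA addbb.
  rewrite ladder_flip_out ?addbF // /l unzip2_zip ?sds //.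
  by apply: contra tD => /dsD.
have := costM (cost_ladder U) (cost_ladder Ul); apply: cost_leq.
by rewrite /= size_zip sds minnn -sE -!mul2n; lia.
Qed.

(* Splitting the controls into halves lets each half serve as work wires for the other. *)
Lemma cost_tofp_big I t d : t \notin I -> d \notin I -> d != t ->
  cost (8 * n) (tofp I t).
Proof.
move=> tI dI dt.
have In : #|I| + 2 <= n.
  have : #|t |: (d |: I)| <= n by rewrite -[X in _ <= X]card_ord max_card.
  by rewrite !cardsU1 dI !inE negb_or eq_sym dt tI !add1n addn2.
have [I2|I2] := leqP #|I| 2; first by apply: cost_leq (cost_tofp tI I2); lia.
(* Halves differing by at most one leave enough work wires: [t] and the second half for the gate on
   [d], the first half for the gate on [t]. *)
pose s := take (uphalf #|I|) (enum I).
pose I1 := [set i in s].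
have I1s : I1 \subset I by apply/subsetP => i; rewrite inE => /mem_take; rewrite mem_enum.
have cI1 : #|I1| = uphalf #|I|.
  rewrite cardsE; have /card_uniqP-> : uniq s by rewrite take_uniq ?enum_uniq.
  by rewrite size_takel // -cardE; lia.
have cI2 : #|I :\: I1| = #|I| - uphalf #|I| by rewrite cardsDS // cI1.
have dI1 : d \notin I1 by apply: contra dI; apply: subsetP.
have tI1 : t \notin I1 by apply: contra tI; apply: subsetP.
have tI2 : t \notin d |: (I :\: I1) by rewrite !inE negb_or eq_sym dt negb_and tI orbT.
(* A commutator of involutions: [t] receives the conjunction over the second half twice, masked by
   [d] and by [d] plus the conjunction over [I1]. The two add up to the full conjunction, and [d] is
   restored. *)
have -> : tofp I t = tofp I1 d * tofp (d |: (I :\: I1)) t *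
                     (tofp I1 d * tofp (d |: (I :\: I1)) t).
  apply/permP => x; apply/ffunP => k; rewrite !permM.
  set a := tofp I1 d; set b := tofp (d |: _) t.
  have aE y i : a y i = y i (+) ((i == d) && [forall i in I1, y i]) by apply: tofpE.
  have bE y i : b y i = y i (+) ((i == t) && (y d && [forall i in I :\: I1, y i])).
    by rewrite /b tofpE // forall_setU1.
  have E1 y : [forall i in I1, a y i] = [forall i in I1, y i].
    apply: eq_forallb_in => i iI; rewrite aE; case: eqP => [id|]; last by rewrite addbF.
    by rewrite -id iI in dI1.
  have E2 y : [forall i in I :\: I1, a y i] = [forall i in I :\: I1, y i].
    apply: eq_forallb_in => i; rewrite inE => /andP[_ iI].
    rewrite aE; case: eqP => [id|]; last by rewrite addbF.
    by rewrite -id iI in dI.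
  have E3 y : [forall i in I1, b y i] = [forall i in I1, y i].
    apply: eq_forallb_in => i iI; rewrite bE; case: eqP => [id|]; last by rewrite addbF.
    by rewrite -id iI in tI1.
  have E4 y : [forall i in I :\: I1, b y i] = [forall i in I :\: I1, y i].
    apply: eq_forallb_in => i; rewrite inE => /andP[_ iI].
    rewrite bE; case: eqP => [id|]; last by rewrite addbF.
    by rewrite -id iI in tI.
  have E : [forall i in I, x i] = [forall i in I1, x i] && [forall i in I :\: I1, x i].
    apply/forall_inP/andP => [H|[/forall_inP H1 /forall_inP H2] i iI].
      split; apply/forall_inP => i; first by move/(subsetP I1s)/H.
      by rewrite inE => /andP[_ /H].
    by have [/H1//|i1] := boolP (i \in I1); apply: H2; rewrite inE i1.
  rewrite tofpE // E !(bE, aE, E1, E2, E3, E4) !eqxx (negbTE dt) /= !addbF.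
  have td : (t == d) = false by rewrite eq_sym (negbTE dt).
  case: (x d); case: (x k); case: [forall i in I1, x i]; case: (k == t); case: (k == d);
    case: [forall i in I :\: I1, x i] => //.
have c1 : cost (4 * #|I1|) (tofp I1 d).
  apply: (@cost_tofp_dirty _ _ (t |: (I :\: I1))) => //.
  - by rewrite !inE negb_or dt negb_and dI orbT.
  - rewrite disjoint_sym disjoints_subset; apply/subsetP => i.
    by rewrite !inE => /orP[/eqP->|/andP[]] //; apply: contra tI1; rewrite inE.
  - by rewrite cardsU1 !inE negb_and tI orbT cI1 cI2; lia.
have c2 : cost (4 * #|d |: (I :\: I1)|) (tofp (d |: (I :\: I1)) t).
  apply: (@cost_tofp_dirty _ _ I1) => //.
  - rewrite disjoints_subset; apply/subsetP => i.
    by rewrite !inE => /orP[/eqP->|/andP[]] //; move: dI1; rewrite inE.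
  - by rewrite cardsU1 !inE negb_and dI orbT cI1 cI2; lia.
have := costM (costM c1 c2) (costM c1 c2); apply: cost_leq.
by rewrite cardsU1 !inE negb_and dI orbT cI1 cI2; lia.
Qed.

End MultiControl.

(** * Normalising a list of points *)

Section Normalise.
Local Open Scope nat_scope.
Local Open Scope group_scope.
Variable n : nat.
Implicit Types (x y : bitvec n) (A I : {set 'I_n}) (j d : 'I_n).
Implicit Types (p q f : {perm bitvec n}).

(* Wires carrying equal columns are merged: after complementing one representative
   per column, adding it to the other wires of its class turns them into ones. *)
Lemma cost_merge_columns (J : finType) (x : J -> bitvec n) :
  exists p (R : {set 'I_n}), [/\ cost n p, #|R| <= 2 ^ #|J|
    & forall i k, k \notin R -> p (x i) k].
Proof.
pose col k := [ffun i => x i k].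
pose rep k := odflt k [pick k' | col k' == col k].
have col_rep k : col (rep k) = col k.
  by rewrite /rep; case: pickP => [k' /eqP|/(_ k)]; rewrite ?eqxx.
have repE k k' : col k = col k' -> rep k = rep k'.
  move=> e; rewrite /rep; under eq_pick => z do rewrite e.
  by case: pickP => // /(_ k'); rewrite eqxx.
have rep_id k : rep (rep k) = rep k by apply: repE; apply: col_rep.
pose R := [set rep k | k in 'I_n].
have repR k : rep k \in R by apply: imset_f.
have [|p1 c1 p1E] := @cost_layer n (fun=> set0) R.
  by move=> k _; rewrite cards0; split=> //; rewrite disjoints_subset sub0set.
have [|p2 c2 p2E] := @cost_layer n (fun k => [set rep k]) (~: R).
  move=> k _; rewrite cards1; split=> //.
  by rewrite disjoints1 inE negbK repR.
exists (p1 * p2), R; split.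
- by have := costM c1 c2; rewrite cardsC card_ord.
(* Distinct representatives have distinct columns, and a column is a boolean function on [J]. *)
- rewrite -card_bool -card_ffun.
  have injR : {in R &, injective col}.
    by move=> _ _ /imsetP[k _ ->] /imsetP[k' _ ->] /repE; rewrite !rep_id.
  by rewrite -(card_in_imset injR) max_card.
- move=> i k kR; rewrite permM p2E inE kR !p1E (negbTE kR) forall_set1 p1E repR /=.
  have -> : [forall i0 in set0, x i i0] by apply/forall_inP => ?; rewrite inE.
  have : col (rep k) i = col k i by rewrite col_rep.
  by rewrite !ffunE => ->; case: (x i k).
Qed.

(** * Moving points one by one onto unit points *)

Section Compress.
Variables (m : nat) (A : {set 'I_n}) (t : 'I_m -> 'I_n).
Hypotheses (tA : forall i, t i \in A) (t_inj : injective t).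

(* The first point goes to 0 on A, so the later ones are nonzero there and can be
   told apart from all earlier unit points by one or two of their ones. *)
Definition unit_point (i : 'I_m) : bitvec n :=
  [ffun k => (k \notin A) || ((k == t i) && (0 < i))].

(** For [j > 0], a gate controlled by ones of [y] sets wire [t j] if necessary; CNOTs from [t j]
    then clear the other ones of [y] on [A]. Earlier unit points vanish at [t j], so these CNOTs fix
    them. *)
Lemma cost_compress_step (j : 'I_m) (y : bitvec n) :
    (forall k, k \notin A -> y k) -> (forall i : 'I_m, i < j -> y != unit_point i) ->
  exists p, [/\ cost #|A| p, forall i : 'I_m, i < j -> p (unit_point i) = unit_point i,
    p y = unit_point j & forall z k, k \notin A -> p z k = z k].
Proof.
move=> yA y_new.
(* For [j = 0] there is no earlier point to preserve, and NOT gates clear [y] on [A]. *)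
have [j0|j0] := posnP j.
  pose D := [set k in A | y k].
  have [|p cp pE] := @cost_layer n (fun=> set0) D.
    by move=> k _; rewrite cards0; split=> //; rewrite disjoints_subset sub0set.
  have f0 (z : bitvec n) : [forall i in set0, z i] by apply/forall_inP => ?; rewrite inE.
  exists p; split; last 2 first.
  - apply/ffunP => k; rewrite pE f0 !inE ffunE j0 ltnn !andbF orbF andbT.
    by have [_|/yA->//] := boolP (k \in A); case: (y k).
  - by move=> z k kA; rewrite pE inE (negbTE kA) addbF.
  - apply: cost_leq cp; apply: subset_leq_card; apply/subsetP => k.
    by rewrite inE => /andP[].
  - by rewrite j0.
(* Controls of the first gate: two ones of [y] if it has two on [A], since a unit point has at most
   one there; otherwise its single one [u], as an earlier unit point with a one at [u] would equal
   [y]. *)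
have [I [IA I2 tI yI uI]] : exists I, [/\ I \subset A, #|I| <= 2,
    ~~ y (t j) -> t j \notin I, forall k, k \in I -> y k
    & forall i : 'I_m, i < j -> [forall k in I, unit_point i k] = false].
  have uE i k : k \in A -> unit_point i k -> k = t i /\ 0 < i.
    by move=> kA; rewrite ffunE kA /= => /andP[/eqP].
  have [u uA yu] : exists2 u, u \in A & y u.
    (* If [y] vanished on [A], it would be the unit point of index 0, which precedes [j]. *)
    apply/exists_inP; apply: contraT; rewrite negb_exists_in => /forall_inP H.
    have := y_new (Ordinal (leq_trans j0 (ltnW (ltn_ord j)))) j0.
    suff -> : y = unit_point (Ordinal (leq_trans j0 (ltnW (ltn_ord j)))) by rewrite eqxx.
    apply/ffunP => k; rewrite ffunE andbF orbF.
    by have [/H/negbTE|/yA] := boolP (k \in A).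
  have [/exists_inP[v vA /andP[yv vu]]|] := boolP [exists v in A, y v && (v != u)].
    exists [set u; v]; split.
    - by apply/subsetP => k; rewrite !inE => /orP[]/eqP->.
    - by rewrite cards2; case: (_ != _).
    - by move=> yt; apply: contra yt; rewrite !inE => /orP[]/eqP->.
    - by move=> k; rewrite !inE => /orP[]/eqP->.
    move=> i ij; apply/negP => /forall_inP H.
    have [ui _] : u = t i /\ 0 < i by apply: uE => //; apply: H; rewrite !inE eqxx.
    have [vi _] : v = t i /\ 0 < i by apply: uE => //; apply: H; rewrite !inE eqxx orbT.
    by rewrite vi ui eqxx in vu.
  rewrite negb_exists_in => /forall_inP H.
  have yE k : k \in A -> y k = (k == u).
    move=> kA; have := H k kA; rewrite negb_and negbK.
    by have [->|_] := eqVneq k u; [rewrite yu|rewrite orbF => /negbTE].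
  exists [set u]; split.
  - by rewrite sub1set.
  - by rewrite cards1.
  - by move=> yt; apply: contra yt; rewrite !inE => /eqP->.
  - by move=> k; rewrite !inE => /eqP->.
  move=> i ij; rewrite forall_set1; apply/negP => /(uE _ _ uA)[ui i0].
  have /negP[] := y_new i ij; apply/eqP/ffunP => k; rewrite ffunE i0 andbT.
  by have [/yE->|/yA//] := boolP (k \in A); rewrite ui.
have [p1 [c1 p1u p1y p1A]] : exists p, [/\ cost 1 p,
    forall i : 'I_m, i < j -> p (unit_point i) = unit_point i,
    p y (t j) & forall z k, k \notin A -> p z k = z k].
  have [yt|yt] := boolP (y (t j)).
    by exists 1; split => [||//|]; [exact: cost_leq (cost1 n)|..] => *; rewrite perm1.
  exists (tofp I (t j)); have {}tI := tI yt; split.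
  - exact: cost_tofp.
  - by move=> i ij; apply/ffunP => k; rewrite tofpE // uI // andbF addbF.
  - by rewrite tofpE // (negbTE yt) eqxx; apply/forall_inP.
  - move=> z k kA; rewrite tofpE //; case: eqP => [kt|]; last by rewrite addbF.
    by rewrite kt tA in kA.
pose D := [set k in A | (k != t j) && p1 y k].
have [|p2 c2 p2E] := @cost_layer n (fun=> [set t j]) D.
  by move=> k _; rewrite cards1 disjoints1 inE eqxx andbF.
exists (p1 * p2); split.
- apply: cost_leq (costM c1 c2); rewrite (cardsD1 (t j) A) tA leq_add2l.
  apply: subset_leq_card; apply/subsetP => k; rewrite !inE.
  by case/and3P => -> ->.
- move=> i ij; rewrite permM p1u //; apply/ffunP => k; rewrite p2E forall_set1.
  rewrite [unit_point i (t j)]ffunE tA /=.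
  have [/t_inj ji|_] := eqVneq (t j) (t i); first by rewrite ji ltnn in ij.
  by rewrite andbF addbF.
- apply/ffunP => k; rewrite permM p2E forall_set1 p1y andbT ffunE j0 andbT inE.
  have [kA|kA] := boolP (k \in A); last by rewrite addbF p1A // yA.
  by have [->|_] := eqVneq k (t j); rewrite /= ?p1y // addbb.
- move=> z k kA; rewrite permM p2E !inE (negbTE kA) addbF.
  exact: p1A.
Qed.

Lemma cost_compress (x : 'I_m -> bitvec n) : injective x ->
    (forall i k, k \notin A -> x i k) ->
  exists2 p, cost (m * #|A|) p & forall i, p (x i) = unit_point i.
Proof.
move=> x_inj xA.
(* The last clause keeps the points still to be treated equal to one off [A]. *)
suff H : forall j : nat, j <= m -> exists p, [/\ cost (j * #|A|) p,
    forall i : 'I_m, i < j -> p (x i) = unit_point i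
    & forall z k, k \notin A -> p z k = z k].
  by have [p [cp pE _]] := H m (leqnn m); exists p => // i; apply: pE.
elim=> [_|j IH jm].
  by exists 1; split=> [|//|]; [exact: cost1|move=> *; rewrite perm1].
have [p [cp pE pA]] := IH (ltnW jm).
have [||q [cq qu qy qA]] := @cost_compress_step (Ordinal jm) (p (x (Ordinal jm))).
- by move=> k kA; rewrite pA // xA.
- move=> i ij; rewrite -pE //; apply/eqP => /perm_inj/x_inj e.
  by rewrite -e ltnn in ij.
exists (p * q); split.
- by rewrite mulSn addnC; apply: costM.
- move=> i; rewrite ltnS leq_eqVlt permM => /orP[/eqP ij|ij]; last by rewrite pE // qu.
  by rewrite (_ : i = Ordinal jm) ?qy //; apply: val_inj.
- by move=> z k kA; rewrite permM qA // pA.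
Qed.

End Compress.

(** Both families go to the same unit points, and the route from [w] is reversed. Only [x] has its
    columns merged, as [w] is already one off [W]. The set [A] collects the representatives for [x],
    the [m] target wires and [W]. *)
Lemma cost_normalise m (W : {set 'I_n}) (x w : 'I_m -> bitvec n) :
    m <= n -> injective x -> injective w -> (forall i k, k \notin W -> w i k) ->
  exists2 p, cost (n + 2 * (m * (2 ^ m + m + #|W|))) p & forall i, p (x i) = w i.
Proof.
move=> mn x_inj w_inj wW.
have [p [R [cp cR pR]]] := cost_merge_columns x.
rewrite card_ord in cR.
pose t := @widen_ord m n mn.
have t_inj : injective t by move=> i i' /(congr1 val) /= /val_inj.
pose A := R :|: [set t i | i in 'I_m] :|: W.
have tA i : t i \in A by rewrite !inE imset_f ?orbT.
have cA : #|A| <= 2 ^ m + m + #|W|.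
  apply: leq_trans (leq_card_setU _ _) _; rewrite leq_add2r.
  apply: leq_trans (leq_card_setU _ _) _; apply: leq_add => //.
  by rewrite card_imset // card_ord.
have [|i k|q cq qE] := cost_compress tA t_inj (x := fun i => p (x i)).
- by move=> i i' /perm_inj/x_inj.
- by rewrite !inE !negb_or => /andP[/andP[/pR->]].
have [|r cr rE] := cost_compress tA t_inj w_inj.
  by move=> i k; rewrite !inE !negb_or => /andP[_ /wW].
exists (p * q * r^-1); last by move=> i; rewrite !permM qE -rE permK.
apply: cost_leq (costM (costM cp cq) (costV cr)).
by rewrite -addnA leq_add2l mul2n -addnn leq_add // leq_mul2l cA orbT.
Qed.

End Normalise.

(** * Simultaneous exchange of points *)

Section Exchange.
Local Open Scope nat_scope.
Local Open Scope group_scope.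
Variable n : nat.
Implicit Types (x y : bitvec n) (I W : {set 'I_n}).
Implicit Types (p q f : {perm bitvec n}).

(** For [t] in [W], the face [t = 0] of the subcube with free wires [W] and ones elsewhere; [B] is
    the set of ones inside [W]. *)
Definition subcube_face W t : seq (bitvec n) :=
  [seq [ffun k => (k \in B) || (k \notin W)] | B : {set 'I_n} in powerset (W :\ t)].

Lemma mem_subcube_face W t z : t \in W ->
  (z \in subcube_face W t) = [forall k in ~: W, z k] && ~~ z t.
Proof.
move=> tW; apply/imageP/andP => [[B]|[/forall_inP zW zt]].
  rewrite powersetE => /subsetP BW ->; split.
    by apply/forall_inP => k; rewrite !ffunE inE => ->; rewrite orbT.
  rewrite ffunE tW orbF; apply/negP => /BW; by rewrite !inE eqxx.
exists [set k in W :\ t | z k].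
  by rewrite powersetE; apply/subsetP => k; rewrite inE => /andP[].
apply/ffunP => k; rewrite !ffunE !inE.
have [kW|kW] := boolP (k \in W); last by rewrite orbT zW // inE.
by have [->|] := eqVneq k t; rewrite ?(negbTE zt) // orbF.
Qed.

Lemma subcube_face_uniq W t : uniq (subcube_face W t).
Proof.
rewrite map_inj_in_uniq ?enum_uniq // => B B'; rewrite !mem_enum !powersetE.
move=> /subsetP sB /subsetP sB' /ffunP e; apply/setP => k.
have /[!ffunE] := e k; have [kW|kW _] := boolP (k \in W); first by rewrite !orbF.
apply/idP/idP => [/sB|/sB']; by rewrite !inE (negbTE kW) andbF.
Qed.

Lemma size_subcube_face W t : t \in W -> size (subcube_face W t) = (2 ^ #|W|.-1)%N.
Proof. by move=> tW; rewrite size_map -cardE card_powerset (cardsD1 t W) tW. Qed.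

(** With [m = 2 ^ s.+1] points, two normalisations cost [2n + 4m(2^m + m + s.+1)], and the
    controlled NOT between them [8n]. *)
Definition exchange_cost s :=
  (10 * n + 4 * (2 ^ s.+1 * (2 ^ 2 ^ s.+1 + 2 ^ s.+1 + s.+1)))%N.

(** A normalisation [p] sends [a] to the face [c] and [map f a] to the opposite face in matching
    order. [G], the NOT on [t] controlled by all wires outside [W], exchanges these faces, so its
    conjugate by [p] exchanges each [x] with [f x]. *)
Lemma cost_exchange s f (a : seq (bitvec n)) :
    0 < s -> 2 ^ s.+1 <= n -> size a = (2 ^ s)%N -> uniq (a ++ map f a) ->
  exists g, [/\ cost (exchange_cost s) g,
    {in a, forall x, g x = f x /\ g (f x) = x}
    & forall y, y \notin a ++ map f a -> g y = y].
Proof.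
move=> s0 mn sa Ua.
have sn : s.+1 <= n by apply: leq_trans mn; apply: ltnW; apply: ltn_expl.
pose W := [set widen_ord sn i | i : 'I_s.+1].
have cW : #|W| = s.+1.
  by rewrite card_imset ?card_ord // => i j /(congr1 val) /= /val_inj.
(* A second wire [d] in [W] is the spare wire borrowed by the controlled NOT. *)
have /card_gt1P[t [d [tW dW td]]] : 1 < #|W| by rewrite cW ltnS.
pose G := tofp (~: W) t.
have tI : t \notin ~: W by rewrite inE negbK.
have GE z k : G z k = z k (+) ((k == t) && [forall i in ~: W, z i]) by apply: tofpE.
have cG : cost (8 * n) G.
  by apply: (@cost_tofp_big _ _ _ d) => //; rewrite 1?eq_sym // inE negbK.
have GG z : G (G z) = z by rewrite -permM tofpK perm1.
pose c := subcube_face W t.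
have sc : size c = (2 ^ s)%N by rewrite size_subcube_face // cW.
have cE z : (z \in c) = [forall k in ~: W, z k] && ~~ z t by apply: mem_subcube_face.
have GW z : [forall k in ~: W, G z k] = [forall k in ~: W, z k].
  apply: eq_forallb_in => k kW; rewrite GE; case: eqP => [kt|]; last by rewrite addbF.
  by rewrite -kt kW in tI.
have Uc : uniq (c ++ map G c).
  rewrite cat_uniq subcube_face_uniq map_inj_uniq ?subcube_face_uniq ?andbT; last exact: perm_inj.
  apply/hasPn => _ /mapP[z zc ->]; rewrite /= -/c cE GW.
  by move: zc; rewrite cE => /andP[zW /negbTE zt]; rewrite GE zW zt eqxx.
have size2 h (u : seq (bitvec n)) : size u = (2 ^ s)%N -> size (u ++ map h u) = (2 ^ s.+1)%N.
  by move=> su; rewrite size_cat size_map su addnn expnS mul2n.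
pose x0 : bitvec n := [ffun=> true].
have nth_injI (u : seq (bitvec n)) : uniq u -> size u = (2 ^ s.+1)%N ->
    injective (fun i : 'I_(2 ^ s.+1) => nth x0 u i).
  move=> Uu su i j /eqP; rewrite nth_uniq ?su // => /eqP; exact: val_inj.
have cW' i k : k \notin W -> i \in c ++ map G c -> i k.
  move=> kW; rewrite mem_cat => /orP[|/mapP[z + ->]]; rewrite cE => /andP[+ _]; last rewrite -GW.
    by move=> /forall_inP; apply; rewrite inE.
  by move=> /forall_inP; apply; rewrite inE.
have [||i k kW|p cp pE] := @cost_normalise n (2 ^ s.+1) W
  (fun i => nth x0 (a ++ map f a) i) (fun i => nth x0 (c ++ map G c) i) mn.
- by apply: nth_injI => //; apply: size2.
- by apply: nth_injI => //; apply: size2.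
- by apply: cW' => //; apply: mem_nth; rewrite size2.
have {}pE i : i < 2 ^ s.+1 -> p (nth x0 (a ++ map f a) i) = nth x0 (c ++ map G c) i.
  by move=> im; have := pE (Ordinal im).
have pa i : i < 2 ^ s -> p (nth x0 a i) = nth x0 c i.
  move=> im; have := pE i; rewrite !nth_cat sa sc im; apply.
  by apply: leq_trans im _; rewrite leq_exp2l.
have pfa i : i < 2 ^ s -> p (f (nth x0 a i)) = G (nth x0 c i).
  have lt : (2 ^ s + i < 2 ^ s) = false by rewrite ltnNge leq_addr.
  move=> im; have := pE (2 ^ s + i)%N; rewrite !nth_cat sa sc lt addKn.
  rewrite !(nth_map x0) ?sa ?sc //; apply.
  by rewrite expnS mul2n -addnn ltn_add2l.
exists (p * G * p^-1); split.
- apply: cost_leq (costM (costM cp cG) (costV cp)).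
  by rewrite /exchange_cost cW; lia.
- move=> x xa; have im : index x a < 2 ^ s by rewrite -sa index_mem.
  rewrite -(nth_index x0 xa) !permM pfa // pa // GG -pa // permK; split=> //.
  by rewrite pa // -pfa // permK.
move=> y ya; rewrite !permM.
(* The two faces exhaust the subcube, so [p y] has a zero outside [W] and the controls of [G]
   fail. *)
suff -> : G (p y) = p y by rewrite permK.
have pyc : p y \notin c ++ map G c.
  apply: contra ya => /(nthP x0)[i]; rewrite size2 // => im.
  by rewrite -pE // => /perm_inj <-; apply: mem_nth; rewrite size2.
apply/ffunP => k; rewrite GE; case: eqP => [_|]; last by rewrite addbF.
suff /negbTE-> : ~~ [forall i in ~: W, p y i] by rewrite addbF.
apply: contra pyc => pyW; rewrite mem_cat.
have [yt|yt] := boolP (p y t); last by rewrite cE pyW yt.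
by rewrite -[p y]GG map_f ?orbT // cE GW pyW GE yt pyW eqxx.
Qed.

End Exchange.

(** * Disjoint pairs among the moved points *)

Section Descent.
Local Open Scope nat_scope.
Local Open Scope group_scope.
Variables (T : finType).
Implicit Types (f g : {perm T}).

Definition moved f := [set x | f x != x].

Lemma moved_perm f x : (f x \in moved f) = (x \in moved f).
Proof. by rewrite !inE (inj_eq perm_inj). Qed.

(** Greedy choice: a moved point outside [a], [f a] and [f^-1 a] extends the list, and these exclude
    at most [3 * size a] points. *)
Lemma moved_disjoint_images f j : 3 * j <= #|moved f| ->
  exists a : seq T, [/\ size a = j, uniq (a ++ map f a) & {subset a <= moved f}].
Proof.
elim: j => [_|j IH jM]; first by exists [::].
have [|a [sa Ua aM]] := IH; first by apply: leq_trans jM; rewrite leq_mul2l leqnSn.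
pose b := [set x in a ++ map f a ++ map f^-1 a].
have cb : #|b| < #|moved f|.
  rewrite cardsE; apply: leq_ltn_trans (card_size _) _.
  by rewrite !size_cat !size_map sa; apply: leq_trans jM; lia.
have /subsetPn[x xM xb] : ~~ (moved f \subset b).
  by apply/negP => /subset_leq_card; rewrite leqNgt cb.
exists (x :: a); split; first by rewrite /= sa.
  move: xb; rewrite inE !mem_cat !negb_or => /and3P[xa xfa xf'a].
  have fxa : f x \notin a.
    by apply: contra xf'a => /(map_f f^-1); rewrite permK.
  rewrite /= mem_cat inE !negb_or xa xfa andbT.
  move: xM; rewrite inE eq_sym => -> /=.
  by rewrite uniq_catC /= mem_cat negb_or (mem_map perm_inj) xa fxa /= uniq_catC.
by move=> y; rewrite inE => /orP[/eqP->|/aM].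
Qed.

End Descent.

(** * Descent on the number of moved points *)

Section Synthesis.
Local Open Scope nat_scope.
Local Open Scope group_scope.
Variable n : nat.
Implicit Types (f g p : {perm bitvec n}).

(** Each exchange fixes [2 ^ s] moved points and moves no new one, so the quotient bounds the number
    of batches. *)
Lemma cost_reduce s f : 0 < s -> 2 ^ s.+1 <= n ->
  exists2 g, cost (exchange_cost n s * (#|moved f| %/ 2 ^ s)) g
    & #|moved (f * g)| <= 3 * 2 ^ s.
Proof.
move=> s0 mn; have [M] := ubnP #|moved f|; elim: M f => // M IH f fM.
have [small|/ltnW/moved_disjoint_images[a [sa Ua aM]]] := leqP #|moved f| (3 * 2 ^ s).
  by exists 1; [exact: cost_leq (cost1 n)|rewrite mulg1].
have [g [cg ga g_out]] := cost_exchange s0 mn sa Ua.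
have sub : moved (f * g) \subset moved f :\: [set x in a].
  apply/subsetP => x; rewrite !inE permM => H; apply/andP; split.
    by apply: contra H => xa; have [_ ->] := ga x xa.
  apply: contra H => /eqP fx; rewrite fx g_out // mem_cat; apply/negP => /orP[/aM|].
    by rewrite inE fx eqxx.
  by rewrite -{1}fx (mem_map perm_inj) => /aM; rewrite inE fx eqxx.
have sa' : #|[set x in a]| = (2 ^ s)%N.
  rewrite cardsE -sa; apply/card_uniqP.
  by move: Ua; rewrite cat_uniq => /and3P[].
have aM' : [set x in a] \subset moved f by apply/subsetP => x; rewrite inE => /aM.
have K0 : 0 < 2 ^ s by rewrite expn_gt0.
have le1 : #|moved (f * g)| <= #|moved f| - 2 ^ s.
  by have := subset_leq_card sub; rewrite cardsDS // sa'.
have leK : 2 ^ s <= #|moved f| by rewrite -sa' subset_leq_card.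
have [|h ch hM] := IH (f * g).
  by move: le1 leK fM K0; move: #|moved f| #|moved (f * g)| (2 ^ s)%N => u v K; lia.
exists (g * h); last by rewrite mulgA.
apply: cost_leq (costM cg ch).
rewrite -[X in X + _]muln1 -mulnDr leq_mul2l; apply/orP; right.
rewrite -(subnK leK) divnDr ?dvdnn // divnn K0 addnC leq_add2r.
exact: leq_div2r.
Qed.

(* The spare transposition (u v) makes each single exchange an even permutation. *)
Lemma cost_reduce_pairs f (u v : bitvec n) : 4 <= n -> u != v ->
    u \notin moved f -> v \notin moved f ->
  cost (exchange_cost n 1 * #|moved f|) f \/
  cost (exchange_cost n 1 * #|moved f|) (f * tperm u v).
Proof.
move=> n4 uv; have [M] := ubnP #|moved f|; elim: M f => // M IH f fM fu fv.
have [f0|[x xM]] := set_0Vmem (moved f).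
  left; suff -> : f = 1 by apply: cost_leq (cost1 n).
  apply/permP => x; rewrite perm1; apply/eqP; apply: contraT => xf.
  by have : x \in moved f; [rewrite inE|rewrite f0 inE].
have Efu : f u = u by move: fu; rewrite inE negbK => /eqP.
have Efv : f v = v by move: fv; rewrite inE negbK => /eqP.
have fxM : f x \in moved f by rewrite moved_perm.
have nu y : y \in moved f -> u != y by apply: contraTneq => <-.
have nv y : y \in moved f -> v != y by apply: contraTneq => <-.
(* [h] sends [x] to [f x] and [u] to [v]: the two disjoint pairs of an exchange with [s = 1]. *)
pose h := f * tperm u v.
have hx : h x = f x by rewrite permM tpermD ?nu ?nv.
have hu : h u = v by rewrite permM Efu tpermL.
have Ua : uniq ([:: x; u] ++ map h [:: x; u]).
  rewrite /= !inE !negb_or hx hu (eq_sym x u) (eq_sym x v) (eq_sym (f x) v).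
  rewrite (nu x) // (nv x) // (nu (f x)) // (nv (f x)) // uv.
  by move: xM; rewrite inE eq_sym => ->.
have [|g [cg ga g_out]] := cost_exchange (isT : 0 < 1) _ (erefl : size [:: x; u] = (2 ^ 1)%N) Ua.
  by [].
have [gx gfx] : g x = f x /\ g (f x) = x.
  by have := ga x; rewrite hx => H; apply: H; rewrite inE eqxx.
have [gu gv] : g u = v /\ g v = u.
  by have := ga u; rewrite hu => H; apply: H; rewrite !inE eqxx orbT.
pose k := h * g.
have ku : k u = u by rewrite permM hu gv.
have kv : k v = v by rewrite !permM Efv tpermR gu.
have sub : moved k \subset moved f :\ x.
  apply/subsetP => y; rewrite !inE => ky; apply/andP; split.
    by apply: contra ky => /eqP->; rewrite permM hx gfx.
  apply: contra ky => /eqP fy.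
  have [->|yu] := eqVneq y u; first by rewrite ku.
  have [->|yv] := eqVneq y v; first by rewrite kv.
  have yM : y \notin moved f by rewrite inE fy eqxx.
  rewrite !permM fy tpermD 1?eq_sym // g_out //=.
  rewrite !inE !negb_or hx hu yu yv !andbT /=.
  by apply/andP; split; apply: contraNneq yM => ->.
have := subset_leq_card sub; have := cardsD1 x (moved f); rewrite xM => -> le.
have cc : exchange_cost n 1 * #|moved k| + exchange_cost n 1 <=
    exchange_cost n 1 * (true + #|moved f :\ x|).
  by rewrite mulnDr muln1 addnC leq_add2l leq_mul2l le orbT.
(* The alternatives trade places: a circuit for [k] gives one for [f * tperm u v], and one for
   [k * tperm u v] gives one for [f], because [g] exchanges [u] and [v] and thus commutes with
   [tperm u v]. *)
have [|||ck|ck] := IH k.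
- by move: fM; rewrite (cardsD1 x) xM add1n ltnS; apply: leq_ltn_trans le.
- by rewrite inE ku eqxx.
- by rewrite inE kv eqxx.
- right; have := costM ck (costV cg); rewrite mulgK; exact: cost_leq.
left; have := costM ck (costV cg).
have comm : tperm u v * g = g * tperm u v by rewrite conjgC tpermJ gu gv tpermC.
have -> : k * tperm u v * g^-1 = f.
  by rewrite /k /h -(mulgA f) comm -!mulgA (mulgA (tperm u v)) tperm2 mul1g mulgV mulg1.
exact: cost_leq.
Qed.

End Synthesis.

(** * Parity, and the bound for all implementable maps *)

Section Parity.
Local Open Scope nat_scope.
Local Open Scope group_scope.
Variable n : nat.
Hypothesis n4 : 4 <= n.
Implicit Types (f g p : {perm bitvec n}).

(* Splitting on the value of an unused wire b writes the gate as a product of two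
   conjugate permutations. *)
Lemma odd_tofp (I : {set 'I_n}) j : j \notin I -> #|I| <= 2 -> odd_perm (tofp I j) = false.
Proof.
move=> jI I2.
have [b] : exists b, b \notin j |: I.
  apply/existsP; rewrite -negb_forall; apply: contraL n4 => /forallP H.
  suff : #|'I_n| <= #|j |: I| by rewrite card_ord cardsU1 jI add1n; lia.
  by apply: subset_leq_card; apply/subsetP => k _; apply: H.
rewrite !inE negb_or => /andP[bj bI].
have jbI : j \notin b |: I by rewrite !inE negb_or eq_sym bj.
have -> : tofp I j = tofp (b |: I) j * (tofp set0 b * tofp (b |: I) j * tofp set0 b).
  apply/permP => x; apply/ffunP => k; rewrite !permM.
  set N := tofp set0 b; set a := tofp (b |: _) j.
  have NE y i : N y i = y i (+) (i == b).
    rewrite tofpE ?inE //; congr (_ (+) _); rewrite andb_idr // => _.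
    by apply/forall_inP => ?; rewrite inE.
  have aE y i : a y i = y i (+) ((i == j) && (y b && [forall i in I, y i])).
    by rewrite tofpE // forall_setU1.
  have NI y : [forall i in I, N y i] = [forall i in I, y i].
    apply: eq_forallb_in => i iI; rewrite NE; case: eqP => [ib|]; last by rewrite addbF.
    by rewrite -ib iI in bI.
  have aI y : [forall i in I, a y i] = [forall i in I, y i].
    apply: eq_forallb_in => i iI; rewrite aE; case: eqP => [ij|]; last by rewrite addbF.
    by rewrite -ij iI in jI.
  rewrite tofpE // !(aE, NE, NI, aI) eqxx (negbTE bj) /= !addbF.
  by case: (x k); case: (x b); case: (k == j); case: (k == b); case: [forall i in I, x i].
by rewrite !odd_permM; case: (odd_perm _); case: (odd_perm _).
Qed.

Lemma circuit_perm (S : seq (gate n)) : circuit S ->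
  exists p : {perm bitvec n}, odd_perm p = false /\ forall x, circuit_transf S x = p x.
Proof.
elim: S => [_|[I j] S IH cS]; first by exists 1; rewrite odd_perm1; split=> // x; rewrite perm1.
have [|p [op pE]] := IH; first by move=> g gS; apply: cS; rewrite inE gS orbT.
have : (I, j) \in Omega2 n by apply: cS; rewrite inE eqxx.
rewrite inE => /andP[/= jI I2].
exists (tofp I j * p); split; first by rewrite odd_permM odd_tofp // op.
by move=> x; rewrite permM -pE permE /tof_fun (negbTE jI).
Qed.

Lemma cost_even c p : cost c p -> odd_perm p = false.
Proof.
move=> [S [cS _ SE]]; have [q [oq qE]] := circuit_perm cS.
by have -> : p = q; first by apply/permP => x; rewrite -SE qE.
Qed.

Definition permute_wires (s : 'S_n) (x : bitvec n) : bitvec n := [ffun k => x (s k)].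

Lemma permute_wires_inj s : injective (permute_wires s).
Proof.
move=> x y /ffunP e; apply/ffunP => k.
by have := e (s^-1 k); rewrite !ffunE permKV.
Qed.

Definition wire_perm s : {perm bitvec n} := perm (@permute_wires_inj s).

Lemma wire_permE s x k : wire_perm s x k = x (s k).
Proof. by rewrite permE ffunE. Qed.

Lemma wire_permM s s' : wire_perm (s * s') = wire_perm s' * wire_perm s.
Proof. by apply/permP => x; apply/ffunP => k; rewrite !(permM, wire_permE). Qed.

(** A wire permutation is a product of transpositions of wires, each made of three CNOTs, which are
    even. *)
Lemma odd_wire_perm s : odd_perm (wire_perm s) = false.
Proof.
have [ts -> _] := prod_tpermP s.
elim: ts => [|[i j] ts IH]; rewrite (big_nil, big_cons) /=.
  suff -> : wire_perm 1 = 1 by rewrite odd_perm1.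
  by apply/permP => x; apply/ffunP => k; rewrite wire_permE !perm1.
rewrite wire_permM odd_permM IH /=.
have [->|ij] := eqVneq i j.
  rewrite tperm1; suff -> : wire_perm 1 = 1 by rewrite odd_perm1.
  by apply/permP => x; apply/ffunP => k; rewrite wire_permE !perm1.
have ji : (j == i) = false by rewrite eq_sym (negbTE ij).
have -> : wire_perm (tperm i j) = tofp [set i] j * tofp [set j] i * tofp [set i] j.
  apply/permP => x; apply/ffunP => k; rewrite wire_permE !permM.
  rewrite !(tofpE, forall_set1) ?inE ?ji // ?eqxx ?(negbTE ij) ?ji /= ?addbF.
  case: tpermP => [->|->|/eqP/negbTE-> /eqP/negbTE->]; rewrite /= ?addbF //.
  - by rewrite eqxx (negbTE ij) /= addbF; case: (x i); case: (x j).
  - by rewrite eqxx ji /= addbF; case: (x i); case: (x j).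
by rewrite !odd_permM !odd_tofp ?inE ?ji ?cards1.
Qed.

Lemma F0_even_perm (f : transf n) : f \in F0 n ->
  exists p : {perm bitvec n}, odd_perm p = false /\ forall x, f x = p x.
Proof.
rewrite inE => /asboolP[S [cS [s sE]]].
have [p [op pE]] := circuit_perm cS.
exists (p * wire_perm s); rewrite odd_permM op odd_wire_perm; split=> // x.
by rewrite sE permM -pE permE.
Qed.

(** After the batches, at most [3 * 2 ^ s] moved points remain; they are fixed one at a time, each
    charged the cost of a full batch. *)
Lemma cost_even_perm s f : 0 < s -> 2 ^ s.+1 <= n -> odd_perm f = false ->
  cost (exchange_cost n s * (2 ^ n %/ 2 ^ s + 3 * 2 ^ s)) f.
Proof.
move=> s0 mn of_.
have cT : #|bitvec n| = (2 ^ n)%N by rewrite card_ffun card_bool card_ord.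
have [g cg small] := cost_reduce f s0 mn.
have [og ofg] : odd_perm g = false /\ odd_perm (f * g) = false.
  by rewrite odd_permM of_ (cost_even cg).
(* Room for two fixed points of [f * g], the spare pair of the last stage. *)
have few : 3 * 2 ^ s + 2 <= 2 ^ n.
  have : n < 2 ^ n.-1 by case: (n) n4 => [//|[//|[//|k _]]] /=; elim: k => [//|k IH]; rewrite expnS; lia.
  have : (2 ^ n = 2 * 2 ^ n.-1)%N by rewrite -expnS prednK // (leq_trans _ n4).
  by move: mn; rewrite expnS; lia.
have [u [v [uM vM uv]]] : exists u v, [/\ u \notin moved (f * g), v \notin moved (f * g) & u != v].
  have : 1 < #|~: moved (f * g)|.
    by have := cardsC (moved (f * g)); rewrite cT; move: few small; lia.
  by case/card_gt1P => u [v []]; rewrite !inE => uM vM uv; exists u, v; rewrite !inE.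
have le1 : exchange_cost n 1 <= exchange_cost n s.
  rewrite /exchange_cost leq_add2l leq_mul2l /=.
  have s1 : 2 ^ 2 <= 2 ^ s.+1 by rewrite leq_exp2l.
  by apply: leq_mul => //; apply: leq_add => //; apply: leq_add => //; rewrite leq_exp2l.
have cfg : cost (exchange_cost n 1 * #|moved (f * g)|) (f * g).
  (* The other outcome would give a circuit for an odd permutation. *)
  have [//|/cost_even] := cost_reduce_pairs n4 uv uM vM.
  by rewrite odd_permM ofg odd_tperm uv.
have := costM cfg (costV cg); rewrite mulgK; apply: cost_leq.
rewrite addnC mulnDr leq_add //.
  by rewrite leq_mul2l leq_div2r ?orbT // -cT max_card.
exact: leq_mul.
Qed.

Lemma Ln0_leq s : 0 < s -> 2 ^ s.+1 <= n ->
  Ln0 n <= exchange_cost n s * (2 ^ n %/ 2 ^ s + 3 * 2 ^ s).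
Proof.
move=> s0 mn; apply/bigmax_leqP => f fF.
have [p [op pE]] := F0_even_perm fF.
have [S [cS sS SE]] := cost_even_perm s0 mn op.
apply: leq_trans sS; apply: (Lf0_min fF).2 => //.
by exists 1 => x; apply/ffunP => k; rewrite ffunE perm1 SE pE.
Qed.

End Parity.

(** * Asymptotics *)

From mathcomp Require Import boolp classical_sets filter reals topology normedtype sequences exp.

Lemma linear_leq_exp b : (20 <= b -> 36 * (10 * b + 10) <= 2 ^ b)%N.
Proof.
move/subnK <-; elim: (b - 20)%N => [|k IH].
  by apply: (@leq_trans (2 ^ 13)); rewrite // leq_exp2l.
by rewrite addSn expnS; lia.
Qed.

Lemma quadratic_leq_exp n : (30 <= n -> 3000 * (n * n.+1) <= 2 ^ n)%N.
Proof.
move/subnK <-; elim: (n - 30)%N => [|k IH].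
  have -> : (0 + 30 = 15 + 15)%N by [].
  rewrite expnD; have h : (4000 <= 2 ^ 15)%N by [].
  by apply: (@leq_trans (4000 * 4000)%N); [lia|apply: leq_mul].
by rewrite addSn expnS; nia.
Qed.

Lemma double_leq_exp m : (0 < m -> 2 * m <= 2 ^ m)%N.
Proof. by case: m => // m _; rewrite expnS leq_mul2l /= ltn_expl. Qed.

(** The factor [(trunc_log 2 n).+1] dominates the real logarithm of [n]. The constant comes from
    [51/5 * 42/9 = 2142/45 < 48]: the first factor bounds an exchange, the second the number of
    batches times the logarithm. *)
Lemma Ln0_log_leq n : (2 ^ 200 <= n -> Ln0 n * (trunc_log 2 n).+1 <= 48 * (n * 2 ^ n))%N.
Proof.
move=> n_large; set L := trunc_log 2 n.
have n0 : (0 < n)%N by apply: leq_trans n_large; rewrite expn_gt0.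
have Ln : (2 ^ L <= n)%N by apply: trunc_logP.
(* Ensures [b >= 20], as [linear_leq_exp] requires, and [s >= 6]. *)
have L200 : (200 <= L)%N by rewrite -(@trunc_expnK 2 200) ?leq_trunc_log.
(* Taking [2 ^ s.+1 <= a] keeps the number of columns below [n^(9/10)]; the remaining factor [2 ^ b]
   absorbs [40 * a]. *)
pose a := (9 * L %/ 10)%N; pose b := (L %/ 10)%N.
have aL : (10 * a <= 9 * L < 10 * a + 10)%N by rewrite /a; lia.
have bL : (10 * b <= L < 10 * b + 10)%N by rewrite /b; lia.
have a0 : (128 <= a)%N by lia.
have a_gt0 : (0 < a)%N by apply: leq_trans a0.
pose r := trunc_log 2 a.
have ra : (2 ^ r <= a)%N by apply: trunc_logP.
have ar : (a < 2 ^ r.+1)%N by apply: trunc_log_ltn.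
have r7 : (7 <= r)%N by rewrite -(@trunc_expnK 2 7) ?leq_trunc_log.
case: r ra ar r7 => // s ra ar s6; rewrite !ltnS in s6.
have K64 : (64 <= 2 ^ s)%N by apply: (@leq_trans (2 ^ 6)); rewrite // leq_exp2l.
set K := (2 ^ s)%N in K64.
have mK : (2 ^ s.+1 = 2 * K)%N by rewrite expnS.
have aK : (a < 4 * K)%N by move: ar; rewrite !expnS -/K; lia.
have Lpow : (L < 2 ^ L)%N by apply: ltn_expl.
have mn : (2 ^ s.+1 <= n)%N by lia.
have n4 : (4 <= n)%N by lia.
have s0 : (0 < s)%N by apply: leq_trans s6.
have cE : (5 * exchange_cost n s <= 51 * n)%N.
  have e1 : (2 ^ 2 ^ s.+1 <= 2 ^ a)%N by rewrite leq_exp2l.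
  have e2 : (2 ^ s.+1 + s.+1 <= 2 ^ 2 ^ s.+1)%N.
    apply: leq_trans (double_leq_exp _); last by rewrite expn_gt0.
    by rewrite mul2n -addnn leq_add2l ltnW // ltn_expl.
  have e3 : (40 * a * 2 ^ a <= n)%N.
    apply: leq_trans Ln; have -> : L = (L - a + a)%N by lia.
    rewrite expnD leq_mul2r; apply/orP; right.
    apply: (@leq_trans (2 ^ b)); last by rewrite leq_exp2l //; lia.
    by apply: leq_trans (linear_leq_exp _); lia.
  have e4 : (2 ^ s.+1 * (2 ^ 2 ^ s.+1 + 2 ^ s.+1 + s.+1) <= a * (2 * 2 ^ a))%N.
    by apply: leq_mul => //; lia.
  by rewrite /exchange_cost; lia.
have := Ln0_leq n4 s0 mn.
have QK : (2 ^ n %/ K * K <= 2 ^ n)%N by apply: leq_divM.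
have quad : (3000 * (n * n.+1) <= 2 ^ n)%N.
  by apply: quadratic_leq_exp; apply: leq_trans (leq_trans Lpow Ln); lia.
rewrite -/K; move: (2 ^ n %/ K)%N QK => Q QK.
(* Main term: [9 * L + 1 <= 40 * K] because [a < 4 * K]; the remaining [8 * Q] is small because
   [K >= 64]. *)
have h1 : (9 * Q * L.+1 * 64 <= 40 * 64 * 2 ^ n + 8 * 2 ^ n)%N.
  have : (Q * 64 <= Q * K)%N by rewrite leq_mul2l K64 orbT.
  have : (Q * (9 * L + 1) <= Q * (40 * K))%N by rewrite leq_mul2l; apply/orP; right; lia.
  by lia.
have h2 : (3000 * (K * L.+1) <= 2 ^ n)%N.
  apply: leq_trans quad; rewrite leq_mul2l /=; apply: leq_mul; first by lia.
  by rewrite ltnS; apply: ltnW; apply: leq_trans Lpow Ln.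
move=> H.
(* The coefficients add up to [40 + 8/64 + 27/3000], below 42. *)
have h3 : (9 * ((Q + 3 * K) * L.+1) <= 42 * 2 ^ n)%N by lia.
have h4 := leq_mul cE h3.
have h5 : (45 * (Ln0 n * L.+1) <= 45 * (exchange_cost n s * (Q + 3 * K) * L.+1))%N.
  by rewrite leq_mul2l leq_mul2r H.
have : (45 * (exchange_cost n s * (Q + 3 * K) * L.+1) =
   5 * exchange_cost n s * (9 * ((Q + 3 * K) * L.+1)))%N by lia.
by have := leq0n (n * 2 ^ n); lia.
Qed.

Import Order.TTheory GRing.Theory Num.Theory numFieldNormedType.Exports.
Local Open Scope classical_set_scope.
Local Open Scope ring_scope.

(** * The real logarithm in base two *)

Section Log2.
Variable R : realType.
Implicit Types x y : R.

Lemma ln2_gt0 : 0 < ln 2 :> R.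
Proof. by rewrite ln_gt0 // ltr1n. Qed.

Lemma ler_log2 x y : 0 < x -> x <= y -> log2 x <= log2 y.
Proof.
move=> x0 xy; rewrite ler_pM2r ?invr_gt0 ?ln2_gt0 // ler_ln ?posrE //.
exact: lt_le_trans xy.
Qed.

Lemma ltr_log2 x y : 0 < x -> x < y -> log2 x < log2 y.
Proof.
move=> x0 xy; rewrite ltr_pM2r ?invr_gt0 ?ln2_gt0 // ltr_ln ?posrE //.
exact: lt_trans xy.
Qed.

Lemma log2_pow k : log2 (2 ^+ k : R) = k%:R.
Proof.
by rewrite /log2 lnXn // -[ln 2 *+ k]mulr_natl mulfK // gt_eqF // ln2_gt0.
Qed.

Lemma log2_ge0 x : 1 <= x -> 0 <= log2 x.
Proof. by move=> x1; rewrite -[0](log2_pow 0) expr0 ler_log2. Qed.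

Lemma log2_div x y : 0 < x -> 0 < y -> log2 (x / y) = log2 x - log2 y.
Proof. by move=> x0 y0; rewrite /log2 ln_div ?posrE // mulrBl. Qed.

Lemma log2_natr_le n : (0 < n)%N -> log2 (n%:R : R) <= (trunc_log 2 n).+1%:R.
Proof.
move=> n0; rewrite -[leRHS]log2_pow ler_log2 ?ltr0n // -natrX ler_nat ltnW //.
exact: trunc_log_ltn.
Qed.

End Log2.

Theorem theorem4 (R : realType) (phi : nat -> R)
    (phi_gt0 : forall n : nat, (1 <= n)%N -> 0 < phi n)
    (phi_oo : phi n @[n --> \oo] --> +oo)
    (phi_lt : forall n : nat, (2 <= n)%N -> phi n < n%:R / log2 (n%:R : R)) :
  exists delta : nat -> R,
    (delta n @[n --> \oo] --> (0 : R)) /\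
    (\forall n \near \oo,
      let N : R := n%:R in
      let eps : R :=
        1 / (6 * phi n) + (8 / 3 - delta n) * (log2 N * log2 (log2 N) / N) in
      (Ln0 n)%:R <=
        3 * N * 2 ^+ (n + 4) / (log2 N - log2 (log2 N) - log2 (phi n))
        * (1 + eps)).
Proof.
(* The bound already holds with [1 + eps] replaced by 1, and [delta = 0] makes [eps] nonnegative for
   large [n]. *)
exists (fun=> 0); split; first exact: cvg_cst.
have [M LnM] : exists M, forall n, (M <= n)%N ->
    (Ln0 n * (trunc_log 2 n).+1 <= 48 * (n * 2 ^ n))%N.
  by exists (2 ^ 200)%N; exact: Ln0_log_leq.
(* Once [phi n >= 1], its logarithm is nonnegative and the denominator [D] is at most [log2 N]. *)
have phi1 : \forall n \near \oo, 1 <= phi n by apply: (cvgryPge _).1 phi_oo 1.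
near=> n; cbv zeta; set N : R := n%:R; set eps := 1 / (6 * phi n) + _.
have n_large : (M <= n)%N by near: n; exact: nbhs_infty_ge.
have ph1 : 1 <= phi n by near: n.
have n2 : (2 <= n)%N by near: n; exact: nbhs_infty_ge.
have n0 : (0 < n)%N by apply: leq_trans n2.
have N0 : 0 < N by rewrite ltr0n.
have lN1 : 1 <= log2 N.
  by rewrite -[1](log2_pow R 1) ler_log2 // expr1 ler_nat.
have lN0 : 0 < log2 N by apply: lt_le_trans lN1.
have llN0 : 0 <= log2 (log2 N) by apply: log2_ge0.
have lphi0 : 0 <= log2 (phi n) by apply: log2_ge0.
have phi0 : 0 < phi n by apply: phi_gt0.
set D := log2 N - log2 (log2 N) - log2 (phi n).
have D0 : 0 < D by rewrite subr_gt0 -log2_div // ltr_log2 // phi_lt.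
have DlN : D <= log2 N by rewrite /D; lra.
have eps0 : 0 <= eps.
  rewrite /eps subr0; apply: addr_ge0; apply: mulr_ge0 => //.
  - by rewrite invr_ge0 mulr_ge0 // ltW.
  - by rewrite divr_ge0.
  - by apply: divr_ge0; [apply: mulr_ge0 => //; apply: ltW|apply: ltW].
(* The constants agree: [3 * 2 ^ 4 = 48]. *)
have main : (Ln0 n)%:R * D <= 3 * N * 2 ^+ (n + 4).
  apply: (@le_trans _ _ ((Ln0 n)%:R * (trunc_log 2 n).+1%:R)).
    by rewrite ler_wpM2l // (le_trans DlN) // log2_natr_le.
  rewrite -natrM; apply: le_trans (_ : (48 * (n * 2 ^ n))%N%:R <= _).
    by rewrite ler_nat LnM.
  by rewrite !natrM natrX exprD -/N; lra.
apply: (@le_trans _ _ (3 * N * 2 ^+ (n + 4) / D)); first by rewrite ler_pdivlMr.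
rewrite ler_peMr // ?lerDl // divr_ge0 ?ltW // !mulr_gt0 ?exprn_gt0 //.
Unshelve. all: by end_near.
Qed.
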